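(* For every $\varepsilon>0$ there is a constant $C(\varepsilon)>0$, depending only on $\varepsilon$, such that for all positive integers $N$ and $Q$ with $1\le Q\le N^{1/2}$ and all $\alpha\in\mathfrak{m}(Q)$, \[ |S(\alpha)|\le C(\varepsilon)\,N^{1+\varepsilon}Q^{-1}. \]
   Context: Here $\mu$ is the Möbius function, $e(x)=e^{2\pi i x}$, and for a positive integer $N$ and real $\alpha$, \[ S(\alpha)=\sum_{n\le N}\mu^2(n)\,e(\alpha n), \] the exponential sum over squarefree integers up to $N$. For positive integers $N$ and $Q$, $\mathfrak{M}(Q)$ denotes the union of all intervals $\{\alpha\in\mathbb{R}: |\alpha q-a|\le QN^{-1}\}$ over integers $a,q$ with $1\le q\le Q$ and $\gcd(a,q)=1$, and \[ \mathfrak{m}(Q)=[QN^{-1},\,1-QN^{-1}]\setminus\mathfrak{M}(Q). \] *)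

(* Defs.v *)
From mathcomp Require Import all_boot all_order all_algebra.
From mathcomp Require Import all_classical all_reals all_analysis.
From mathcomp Require Import complex.

Set Implicit Arguments.
Unset Strict Implicit.
Unset Printing Implicit Defensive.

Import Order.TTheory GRing.Theory Num.Theory.
Import numFieldNormedType.Exports.

Local Open Scope classical_set_scope.
Local Open Scope ring_scope.
Local Open Scope complex_scope.

Definition squarefree (n : nat) : bool :=
  (0 < n)%N && all (fun p => ~~ (p ^ 2 %| n)%N) (primes n).

Definition mobius (n : nat) : int :=
  if squarefree n then (-1) ^+ size (primes n) else 0.

(* e(x) = exp(2 pi i x), given by its real and imaginary parts. *)
Definition e {R : realType} (x : R) : R[i] :=
  cos (2 * pi * x) +i* sin (2 * pi * x).

Definition sqfree_expsum {R : realType} (N : nat) (alpha : R) : R[i] :=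
  \sum_(1 <= n < N.+1) (mobius n ^+ 2)%:~R * e (alpha * n%:R).

Definition major_arcs {R : realType} (N Q : nat) : set R :=
  [set alpha | exists (a : int) (q : nat),
    [/\ (1 <= q <= Q)%N, coprimez a q
      & `|alpha * q%:R - a%:~R| <= Q%:R / N%:R]].

Definition minor_arcs {R : realType} (N Q : nat) : set R :=
  `[Q%:R / N%:R, 1 - Q%:R / N%:R]%classic `\` major_arcs N Q.

(* Main.v *)
Require Import Defs.
From mathcomp Require Import all_boot all_order all_algebra.
From mathcomp Require Import all_classical all_reals all_analysis.
From mathcomp Require Import complex.
From mathcomp Require Import zify ring lra.

(* Writing mu^2(n) = sum_(d^2 | n) mu(d), |S(alpha)| is at most the sum over
   d of |T_d|, where T_d = sum_(m <= N/d^2) e(alpha d^2 m); the d > Q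
   contribute at most N/Q.  By Dirichlet, |alpha q - a| <= Q/N with (a, q) = 1
   and q <= 2N/Q, and alpha being in the minor arcs forces q > Q.  Let rho(d)
   be the distance from a d^2 to q Z.  If rho(d) = 0 then d^2 = q k, and these d
   contribute N/q sum 1/k.  Otherwise |T_d| <= 4q/rho(d): either the geometric
   series gives this, or rho(d) is so small compared with d^2 Q/N that already
   N/d^2 does.  Finally, as d <= Q < q, the sum of 1/rho(d) is controlled by the
   number of d modulo q with a d^2 = c (mod q), which is O(q^eps) on average
   over small c by the divisor bound. *)

Set Implicit Arguments.
Unset Strict Implicit.
Unset Printing Implicit Defensive.

Import Order.TTheory GRing.Theory Num.Theory.
Import numFieldNormedType.Exports.
Import ComplexField.Normc.

Local Open Scope ring_scope.
Local Open Scope complex_scope.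

(** * Divisor counts and the Möbius identity for squarefree numbers *)

(** [divisors] folds over the prime decomposition, and each factor p^k multiplies the length of the
    list by k + 1. The product form lets the divisor bound be proved prime by prime. *)
Lemma size_divisors n :
  size (divisors n) = (\prod_(f <- prime_decomp n) f.2.+1)%N.
Proof.
rewrite /divisors; elim: (prime_decomp n) => [|[p k] s IHs] /=.
  by rewrite big_nil.
rewrite big_cons -IHs /= /PrimeDecompAux.add_divisors; set t := foldr _ _ s.
elim: k => [|k IHk] /=; first by rewrite mul1n.
by rewrite size_merge size_cat size_map IHk [RHS]mulSn addnC.
Qed.

Lemma squarefreeP n :
  reflect (0 < n /\ forall p, prime p -> ~~ (p ^ 2 %| n))%N (squarefree n).
Proof.
apply: (iffP andP) => -[n0 H]; split => //.
  move=> p pp; apply/negP => pn; move/allP: H => /(_ p).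
  rewrite mem_primes pp n0 (dvdn_trans _ pn) ?dvdn_exp//= => /(_ isT).
  by rewrite pn.
by apply/allP => p; rewrite mem_primes => /and3P[/H].
Qed.

Lemma mobius_primeM p d : prime p -> ~~ (p %| d)%N ->
  mobius (p * d) = - mobius d.
Proof.
move=> pp pd; have p0 := prime_gt0 pp.
have d0 : (0 < d)%N by case: d pd => //; rewrite dvdn0.
have cpd : coprime p d by rewrite prime_coprime.
have sz : size (primes (p * d)) = (size (primes d)).+1.
  have -> : (size (primes d)).+1 = size (p :: primes d) by [].
  apply: perm_size; apply: uniq_perm => //=; first exact: primes_uniq.
    by rewrite mem_primes (negbTE pd) !andbF /= primes_uniq.
  by move=> r; rewrite primesM// primes_prime// !inE.
have sq : squarefree (p * d) = squarefree d.
  apply/squarefreeP/squarefreeP => -[_ H]; split=> //.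
  - by move=> r /H; apply: contra; apply: dvdn_mull.
  - by rewrite muln_gt0 p0.
  move=> r pr; apply/negP => rpd.
  have [rp|rp] := eqVneq r p.
    move: rpd pd; rewrite rp expnS expn1 dvdn_pmul2l//.
    by move=> ->.
  have crp : coprime (r ^ 2) p.
    rewrite coprimeXl// prime_coprime//.
    by rewrite dvdn_prime2.
  by move: rpd; rewrite Gauss_dvdr// => rd; have := H r pr; rewrite rd.
by rewrite /mobius sq sz; case: ifP => _; rewrite ?oppr0// exprS mulN1r.
Qed.

Lemma mobius_sq_dvd p d : prime p -> (p ^ 2 %| d)%N -> mobius d = 0.
Proof.
move=> pp pd; rewrite /mobius; case: squarefreeP => // -[_ /(_ _ pp)].
by rewrite pd.
Qed.

Lemma sum_dvdn (V : nmodType) (F : nat -> V) p n : (0 < p)%N ->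
  \sum_(1 <= k < n.+1 | (p %| k)%N) F k =
  \sum_(1 <= k < (n %/ p).+1) F (p * k)%N.
Proof.
move=> p0; rewrite big_mkcond; elim: n => [|n IHn].
  by rewrite div0n !big_geq.
rewrite big_nat_recr//= IHn divnS//; case: ifP => pn; last first.
  by rewrite addr0 add0n.
rewrite add1n [RHS]big_nat_recr//=; congr (_ + F _).
by rewrite -[X in X = _](divnK pn) divnS// pn mulnC.
Qed.

(** For squarefree [n] only d = 1 contributes. Otherwise fix a prime p with p^2 | n: the terms at d
    and p d with p not dividing d cancel, and [mobius] vanishes at multiples of p^2. *)
Lemma sum_mobius_sqdvd n N : (0 < n <= N)%N ->
  \sum_(1 <= d < N.+1 | (d ^ 2 %| n)%N) mobius d = mobius n ^+ 2.
Proof.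
move=> /andP[n0 nN].
case: (boolP (squarefree n)) => sn.
  have -> : mobius n ^+ 2 = 1 by rewrite /mobius sn sqrr_sign.
  have N1 : (1 <= N)%N by apply: leq_trans nN.
  rewrite big_ltn_cond// exp1n dvd1n big_nat_cond big1 ?addr0.
    by rewrite /mobius /squarefree.
  move=> d /andP[/andP[d1 _] dn].
  case/squarefreeP: sn => _ /(_ (pdiv d) (pdiv_prime d1)).
  by rewrite (dvdn_trans _ dn)// dvdn_exp2r// pdiv_dvd.
have [p pp pn] : exists2 p, prime p & (p ^ 2 %| n)%N.
  move: sn; rewrite /squarefree n0 /= => /allPn[p].
  by rewrite mem_primes negbK => /and3P[pp _ _]; exists p.
have -> : mobius n ^+ 2 = 0 by rewrite (mobius_sq_dvd pp pn) expr0n.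
have p0 := prime_gt0 pp.
rewrite big_mkcond /=.
pose F d := if (d ^ 2 %| n)%N then mobius d else 0.
have F0 d : (n < d)%N -> F d = 0.
  move=> nd; rewrite /F; case: ifP => // /(dvdn_leq n0).
  by nia.
(* Terms with d > N vanish, so the range may be stretched to p N; its multiples of p are then
   exactly the p k with k <= N. *)
have Ftrunc (P : pred nat) :
    \sum_(1 <= d < (p * N).+1 | P d) F d = \sum_(1 <= d < N.+1 | P d) F d.
  rewrite (big_cat_nat (n:=N.+1))//=; last by nia.
  rewrite [X in _ + X]big_nat_cond [X in _ + X]big1 ?addr0//.
  by move=> i /andP[/andP[Ni _] _]; apply: F0; apply: leq_ltn_trans Ni.
rewrite -(Ftrunc predT) (bigID (fun d => p %| d)%N) /= sum_dvdn// mulKn//.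
rewrite Ftrunc (bigID (fun d => p %| d)%N) /= big1 ?add0r; last first.
  move=> d pd; rewrite /F (@mobius_sq_dvd p) ?if_same//.
  by rewrite expnS expn1 dvdn_pmul2l.
rewrite -big_split big1// => d pd /=; rewrite /F mobius_primeM//.
have cpd : coprime (p ^ 2) (d ^ 2) by rewrite coprimeXl// coprimeXr// prime_coprime.
by rewrite expnMn Gauss_dvd// pn /=; case: ifP => _; rewrite ?addr0// addNr.
Qed.

Lemma norm_mobius_le1 n : `|mobius n| <= 1.
Proof. by rewrite /mobius; case: ifP => _; rewrite ?normrX ?normrN1 ?expr1n. Qed.

(** * Quadratic congruences modulo [q] *)

(** Members of [A] share their remainder modulo [m], so the quotient [d %/ m], which is below [g],
    separates them. *)
Lemma card_residue_class q m g (A : {set 'I_q}) : q = (m * g)%N ->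
  {in A &, forall d d' : 'I_q, (d = d' %[mod m])%N} -> (#|A| <= g)%N.
Proof.
move=> qE HA; have dP (d : 'I_q) : (d %/ m < g)%N.
  have := ltn_ord d; rewrite [X in (_ < X)%N]qE mulnC.
  by case: (posnP m) => [->|m0]; [rewrite muln0 | rewrite ltn_divLR].
rewrite -[g in (_ <= g)%N]card_ord.
apply: (@leq_card_in _ 'I_g (fun d => Ordinal (dP d))) => d d' dA d'A /(congr1 val) /= e.
by apply: val_inj; rewrite /= (divn_eq d m) (divn_eq d' m) e (HA _ _ dA d'A).
Qed.

(* Fix one solution d0.  A solution d satisfies q | (d - d0)(d + d0), so with
   q1 = gcd(q, d - d0) it is determined modulo lcm(q1, q/q1) = q/g by q1, where
   g = gcd(q1, q/q1).  Moreover g | 2 d0 and g^2 | q, whence g^2 | 4c. *)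
Lemma card_quadratic_congruence (q : nat) (a c : int) : (0 < q)%N ->
  coprimez a q ->
  (#|[set d : 'I_q | (q %| (a * d%:Z ^+ 2 - c)%R)%Z]| <=
   \sum_(q1 <- divisors q | (gcdn q1 (q %/ q1) ^ 2 %| 4 * `|c|)%N)
     gcdn q1 (q %/ q1))%N.
Proof.
move=> q0 caq; set A := [set d | _].
have [->|[d0 d0A]] := set_0Vmem A; first by rewrite cards0.
pose f (d : 'I_q) := gcdn q `|d%:Z - d0%:Z|.
have -> : #|A| = (\sum_(q1 <- divisors q) #|[set d in A | f d == q1]|)%N.
  under eq_bigr do rewrite -sum1dep_card big_mkcondr.
  rewrite exchange_big /= -sum1_card; apply: eq_bigr => d _.
  rewrite -big_mkcond sum1_count (@eq_count _ _ (pred1 (f d))).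
    by rewrite count_uniq_mem ?divisors_uniq// -dvdn_divisors// dvdn_gcdl.
  by move=> x /=; rewrite eq_sym.
rewrite [X in (_ <= X)%N]big_mkcond !big_seq; apply: leq_sum => q1.
rewrite -dvdn_divisors// => q1q; set q2 := (q %/ q1)%N; set g := gcdn q1 q2.
have qE : q = (q1 * q2)%N by rewrite mulnC divnK.
have q10 : (0 < q1)%N by move: q0; rewrite qE muln_gt0 => /andP[].
have fibreP (d : 'I_q) : d \in [set d in A | f d == q1] ->
    (q1 %| d%:Z - d0%:Z)%Z && (q2 %| d%:Z + d0%:Z)%Z.
  rewrite inE => /andP[dA /eqP fd].
  have q1d : (q1 %| d%:Z - d0%:Z)%Z by rewrite dvdzE -fd dvdn_gcdr.
  rewrite q1d /=.
  have : (q %| (d%:Z - d0%:Z) * (d%:Z + d0%:Z))%Z.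
    rewrite -(@Gauss_dvdzr _ a) 1?coprimez_sym//.
    move: dA d0A; rewrite !inE => h1 h2.
    have -> : a * ((d%:Z - d0%:Z) * (d%:Z + d0%:Z)) =
      (a * d%:Z ^+ 2 - c) - (a * d0%:Z ^+ 2 - c) by ring.
    by rewrite rpredB.
  rewrite !dvdzE abszM /= => h.
  (* As q1 = gcd(q, d - d0), the quotient (d - d0)/q1 is prime to q2; cancelling q1 in q1 q2 | (d -
     d0)(d + d0) leaves q2 | d + d0. *)
  have cop : coprime q2 (`|d%:Z - d0%:Z| %/ q1).
    rewrite /coprime -(eqn_pmul2l q10) muln_gcdr muln1 -qE.
    by rewrite mulnC divnK ?[X in X == _]fd// -fd dvdn_gcdr.
  rewrite -(Gauss_dvdr _ cop) -(@dvdn_pmul2l q1)// -qE mulnA.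
  by rewrite [(q1 * _)%N]mulnC divnK.
have [->|[d dF]] := set_0Vmem [set d in A | f d == q1].
  by rewrite cards0.
have /andP[dq1 dq2] := fibreP _ dF.
have gdvd : (g ^ 2 %| 4 * `|c|)%N.
  have gd0 : (g %| 2 * d0%:Z)%Z.
    have -> : 2 * d0%:Z = (d%:Z + d0%:Z) - (d%:Z - d0%:Z) by ring.
    by apply: rpredB; [apply: dvdz_trans dq2 | apply: dvdz_trans dq1];
       rewrite dvdzE /= ?dvdn_gcdr ?dvdn_gcdl.
  have gq : (g ^ 2 %| q)%N by rewrite qE expnS expn1 dvdn_mul// ?dvdn_gcdl ?dvdn_gcdr.
  have -> : (4 * `|c|)%N = `|(4 * c)%R|%N by rewrite abszM.
  have -> : (g ^ 2 %| `|(4 * c)%R|)%N = ((g ^ 2)%N %| (4 * c)%R)%Z by rewrite dvdzE.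
  have -> : 4 * c = a * (2 * d0%:Z) ^+ 2 - 4 * (a * d0%:Z ^+ 2 - c) by ring.
  apply: rpredB; apply: dvdz_mull.
    by rewrite dvdzE abszX /= dvdn_exp2r.
  by apply: (@dvdz_trans q) => //; move: d0A; rewrite inE.
rewrite gdvd; apply: (@card_residue_class _ (lcmn q1 q2)).
  by rewrite muln_lcm_gcd.
move=> x y /fibreP/andP[x1 x2] /fibreP/andP[y1 y2].
apply/eqP; have : (x%:Z == y%:Z %[mod (lcmn q1 q2)])%Z; last by rewrite !modz_nat.
rewrite eqz_mod_dvd dvdzE /= dvdn_lcm; apply/andP; split.
  have := rpredB x1 y1; rewrite dvdzE /=.
  by have -> : x%:Z - d0%:Z - (y%:Z - d0%:Z) = x%:Z - y%:Z by ring.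
have := rpredB x2 y2; rewrite dvdzE /=.
by have -> : x%:Z + d0%:Z - (y%:Z + d0%:Z) = x%:Z - y%:Z by ring.
Qed.

(** * Complex norms and elementary bounds for the sine *)

(* The library states these two for the alias Rcomplex R only. *)
Lemma ler_normcD (R : realType) (x y : R[i]) : normc (x + y) <= normc x + normc y.
Proof. exact: le_normcD. Qed.

Lemma normcNE (R : realType) (x : R[i]) : normc (- x) = normc x.
Proof. exact: normcN. Qed.

Lemma normc_ge0 (R : realType) (x : R[i]) : 0 <= normc x.
Proof. by case: x => a b; exact: sqrtr_ge0. Qed.

Lemma normc_sum (R : realType) (I : Type) (s : seq I) (P : pred I) (F : I -> R[i]) :
  normc (\sum_(i <- s | P i) F i) <= \sum_(i <- s | P i) normc (F i).
Proof.
elim/big_ind2: _ => //; first by rewrite normc0.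
by move=> x a y b xa yb; apply: le_trans (ler_normcD _ _) (lerD xa yb).
Qed.

Lemma sin_MVT (R : realType) (x : R) : 0 <= x ->
  exists2 y : R, 0 <= y <= x & sin x = cos y * x.
Proof.
move=> x0; have [|y] := @MVT_segment R sin cos 0 x x0.
  by apply/continuous_subspaceT => z; exact: continuous_sin.
by rewrite in_itv /= sin0 !subr0 => yx ->; exists y.
Qed.

Lemma norm_sin_le (R : realType) (x : R) : `|sin x| <= `|x|.
Proof.
wlog x0 : x / 0 <= x.
  move=> H; have [/H//|/ltW x0] := lerP 0 x.
  by rewrite -normrN -sinN -[`|x|]normrN H// oppr_ge0.
by have [y _ ->] := sin_MVT x0; rewrite normrM ler_piMl// cos_max.
Qed.

(** Doubling the angle and the mean value theorem give sin x = x cos(x/2) cos y with 0 <= y <= x/2.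
    Cosine decreases there, so the factor of x is at least cos(x/2)^2 = (1 + cos x)/2 >= 1/2. *)
Lemma sin_ge_half (R : realType) (x : R) : 0 <= x <= pi / 2 -> x / 2 <= sin x.
Proof.
move=> /andP[x0 xpi]; have pi0 := pi_gt0 R.
have x2 : x / 2 *+ 2 = x by rewrite -mulr_natr divfK.
have c2 : 2^-1 <= cos (x / 2) ^+ 2.
  have := cos_mulr2n (x / 2); rewrite x2 => h.
  have : 0 <= cos x by apply: cos_ge0_pihalf; lra.
  by rewrite h mulr2n; lra.
have c0 : 0 <= cos (x / 2) by apply: cos_ge0_pihalf; lra.
have [|y /andP[y0 yx] ys] := @sin_MVT _ (x / 2); first lra.
have cc : cos (x / 2) <= cos y.
  have [->//|yx'] := eqVneq y (x / 2).
  rewrite ltW// ltr_cos ?in_itv/=; [|lra|lra].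
  by rewrite lt_neqAle yx' yx.
have := sin_mulr2n (x / 2); rewrite x2 ys => ->.
have : cos (x / 2) ^+ 2 <= cos (x / 2) * cos y by rewrite expr2 ler_wpM2l.
move=> /(le_trans c2)/(ler_wpM2r x0) h; rewrite [leRHS]mulr2n; lra.
Qed.

(** * The additive character [e] and its geometric sums *)

Section ExponentialSums.
Variable R : realType.
Implicit Types x y t : R.

Lemma eD x y : e (x + y) = e x * e y.
Proof.
rewrite /e mulrDr cosD sinD; simpc; congr (_ +i* _); ring.
Qed.

Lemma e0 : e (0 : R) = 1.
Proof. by rewrite /e mulr0 cos0 sin0. Qed.

Lemma eN x : e (- x) * e x = 1.
Proof. by rewrite -eD addNr e0. Qed.

Lemma e_nat (n : nat) : e (n%:R : R) = 1.
Proof.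
elim: n => [|n IHn]; first exact: e0.
rewrite -natr1 eD IHn mul1r /e mulr1 mulrC.
by rewrite mulr_natr cos2pi sin2pi.
Qed.

Lemma e_int (z : int) : e (z%:~R : R) = 1.
Proof.
case: z => n; first exact: e_nat.
by rewrite NegzE mulrNz -[LHS]mulr1 -[X in _ * X](e_nat n.+1) eN.
Qed.

Lemma eMn x (n : nat) : e (x * n%:R) = e x ^+ n.
Proof.
elim: n => [|n IHn]; first by rewrite mulr0 e0.
by rewrite -natr1 mulrDr mulr1 eD IHn exprSr.
Qed.

Lemma normc_e x : normc (e x) = 1.
Proof. by rewrite /normc /e /= cos2Dsin2 sqrtr1. Qed.

Lemma normc_1Be x : normc (1 - e x) = 2 * `|sin (pi * x)|.
Proof.
rewrite /normc /e /= sub0r sqrrN.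
have -> : 2 * pi * x = (pi * x) *+ 2 by rewrite -mulrA mulr_natl.
rewrite cos_mulr2n sin_mulr2n.
have -> : (1 - (cos (pi * x) ^+ 2 *+ 2 - 1)) ^+ 2 + (cos (pi * x) * sin (pi * x) *+ 2) ^+ 2
   = (2 * sin (pi * x)) ^+ 2.
  have := cos2Dsin2 (pi * x).
  set c := cos _; set s := sin _ => h.
  have -> : c ^+ 2 *+ 2 = c ^+ 2 + c ^+ 2 by rewrite mulr2n.
  have c2 : c ^+ 2 = 1 - s ^+ 2 by rewrite -h; ring.
  rewrite -mulr_natl !exprMn c2; ring.
by rewrite sqrtr_sqr normrM ger0_norm.
Qed.

Lemma normc_1Be_le x : normc (1 - e x) <= 2 * pi * `|x|.
Proof.
rewrite normc_1Be -mulrA ler_wpM2l// (le_trans (norm_sin_le _))//.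
by rewrite normrM (ger0_norm (pi_ge0 R)).
Qed.

(** The symmetry sin(pi x) = sin(pi (1 - x)) moves the argument into [0, pi/2], where [sin_ge_half]
    applies. *)
Lemma normc_1Be_frac_ge (r q : nat) : (0 < r < q)%N ->
  pi * (minn r (q - r))%:R / q%:R <= normc (1 - e (r%:R / q%:R : R)).
Proof.
move=> /andP[r0 rq]; rewrite normc_1Be.
have pi0 := pi_gt0 R; have q0 : 0 < q%:R :> R by rewrite ltr0n; lia.
set x := r%:R / q%:R.
suff H : pi * ((minn r (q - r))%:R / q%:R) / 2 <= sin (pi * x).
  apply: (@le_trans _ _ (2 * sin (pi * x))); first by rewrite -mulrA; lra.
  by rewrite ler_wpM2l// ler_norm.
have yE : (q - r)%:R / q%:R = 1 - x.
  by rewrite /x natrB ?(ltnW rq)// mulrBl divff// gt_eqF.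
rewrite /minn; case: ltnP => rr.
  apply: sin_ge_half; rewrite mulr_ge0//= ?pi_ge0// ?divr_ge0//.
  by rewrite ler_pM2l// ler_pdivrMr// -ler_pdivrMl// invrK -natrM ler_nat; lia.
have -> : sin (pi * x) = sin (pi * (1 - x)).
  by rewrite mulrBr mulr1 sinB sinpi cospi mul0r sub0r mulN1r opprK.
rewrite yE; apply: sin_ge_half; rewrite -yE mulr_ge0//= ?pi_ge0// ?divr_ge0//.
by rewrite ler_pM2l// ler_pdivrMr// -ler_pdivrMl// invrK -natrM ler_nat; lia.
Qed.

(** Multiplying by 1 - e(x) telescopes. The product form also covers integral [x], where this factor
    is zero. *)
Lemma normc_geom x M :
  normc (\sum_(1 <= m < M.+1) e (x * m%:R)) * normc (1 - e x) <= 2.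
Proof.
rewrite -normcM mulr_suml.
have -> : \sum_(1 <= m < M.+1) e (x * m%:R) * (1 - e x) = e x - e x ^+ M.+1.
  rewrite -[RHS]opprB -[X in - (_ - X)]expr1 -telescope_sumr// -sumrN.
  apply: eq_bigr => m _; rewrite eMn exprSr; ring.
by rewrite (le_trans (ler_normcD _ _))// normcNE -eMn !normc_e.
Qed.

(** A perturbation argument: the error t costs at most 2 pi |t| <= pi rho/(2q), half of the lower
    bound pi rho/q for |1 - e(r/q)|. What remains is at least rho/q because pi >= 2. *)
Lemma normc_geom_frac x (k : int) (r q M : nat) : (0 < r < q)%N ->
  `|x - k%:~R - r%:R / q%:R| <= (minn r (q - r))%:R / (4 * q%:R) ->
  normc (\sum_(1 <= m < M.+1) e (x * m%:R)) <= 2 * q%:R / (minn r (q - r))%:R.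
Proof.
move=> rq xr; set t := x - _ - _ in xr; set rho := minn _ _ in xr *.
have pi2 := pi_ge2 R; have q0 : 0 < q%:R :> R by rewrite ltr0n; lia.
have rho0 : 0 < rho%:R :> R by rewrite ltr0n /rho; lia.
have ex : e x = e (r%:R / q%:R) * e t.
  have -> : x = k%:~R + (r%:R / q%:R + t) by rewrite /t; ring.
  by rewrite eD e_int mul1r eD.
have H1 := normc_1Be_frac_ge rq; rewrite -/rho in H1.
have H2 : normc (1 - e (r%:R / q%:R)) <= normc (1 - e x) + normc (1 - e t).
  have -> : 1 - e (r%:R / q%:R) = (1 - e x) + (- e (r%:R / q%:R) * (1 - e t)).
    rewrite ex; ring.
  by rewrite (le_trans (ler_normcD _ _))// normcM normcNE normc_e mul1r.
have H3 : normc (1 - e t) <= pi * (rho%:R / q%:R) / 2.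
  apply: le_trans (normc_1Be_le _) _.
  apply: (@le_trans _ _ (2 * pi * (rho%:R / (4 * q%:R)))).
    by rewrite ler_pM2l//; lra.
  rewrite invfM; lra.
have y0 : 0 < rho%:R / q%:R :> R by rewrite divr_gt0.
have H4 : rho%:R / q%:R <= normc (1 - e x).
  rewrite -mulrA in H1; nra.
rewrite ler_pdivlMr// -ler_pdivrMr// -mulrA; apply: le_trans (normc_geom x M).
by rewrite ler_wpM2l ?normc_ge0.
Qed.

Lemma normc_expsum_le x M : normc (\sum_(1 <= m < M.+1) e (x * m%:R)) <= M%:R.
Proof.
apply: le_trans (normc_sum _ _ _) _.
under eq_bigr do rewrite normc_e.
by rewrite sumr_const_nat subn1.
Qed.

End ExponentialSums.

(** * Harmonic sums and the divisor bound *)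

Section Estimates.
Variable R : realType.

(** Serves to compare reciprocals over a sparse set of quotients with a full harmonic sum. *)
Lemma ler_sum_inj (I : finType) (P : pred I) (h : I -> nat) (F : nat -> R) n :
  (forall k, 0 <= F k) -> {in P &, injective h} ->
  (forall i, P i -> (h i < n)%N) ->
  \sum_(i | P i) F (h i) <= \sum_(k < n) F k.
Proof.
move=> F0 hI hn.
have -> : \sum_(i | P i) F (h i) = \sum_(k <- [seq h i | i <- enum P]) F k.
  by rewrite big_map big_enum.
rewrite -(big_mkord predT F).
have hU : uniq [seq h i | i <- enum P].
  rewrite map_inj_in_uniq ?enum_uniq// => i j; rewrite !mem_enum; exact: hI.
rewrite [leRHS](bigID [in [seq h i | i <- enum P]])/= -[X in X + _]big_filter.
rewrite [X in X + _](perm_big [seq h i | i <- enum P])/=.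
  by rewrite lerDl sumr_ge0.
apply: uniq_perm => //; first by rewrite filter_uniq// iota_uniq.
move=> k; rewrite mem_filter mem_index_iota /=.
by apply/andP/idP => [[]//|kh]; split=> //; case/mapP: kh => i; rewrite mem_enum => /hn + ->.
Qed.

(* The term k = 0 is 0^-1 = 0. *)
Definition harmonic_sum (n : nat) : R := \sum_(k < n.+1) k%:R^-1.

Lemma harmonic_sum_ge0 n : 0 <= harmonic_sum n.
Proof. by apply: sumr_ge0 => k _; rewrite invr_ge0. Qed.

(** The induction step is ln(1 + x) <= x at x = -1/(n + 2). *)
Lemma harmonic_sum_le_ln n : (0 < n)%N -> harmonic_sum n <= 1 + ln n%:R.
Proof.
case: n => // n _; elim: n => [|n IHn].
  by rewrite /harmonic_sum !big_ord_recr big_ord0 /= invr0 invr1 ln1 !add0r addr0.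
rewrite /harmonic_sum big_ord_recr /=.
have n0 : 0 < n.+1%:R :> R by [].
have n1 : 0 < n.+2%:R :> R by [].
have H : ln (n.+1%:R / n.+2%:R) <= - n.+2%:R^-1 :> R.
  have -> : n.+1%:R / n.+2%:R = 1 + - n.+2%:R^-1 :> R.
    by rewrite -[n.+1%:R](addrK 1) natr1 mulrBl divff ?gt_eqF// mul1r.
  by apply: le_ln1Dx; rewrite ltrN2 invf_lt1// ltr1n.
rewrite ln_div ?posrE// in H.
rewrite -lerBrDr (le_trans IHn)//.
by move: (ln _) (ln _) (_^-1) H => x y z H; lra.
Qed.

(** Applying ln y < y to y = n^d gives ln n <= n^d / d, which explains the constant 1 + 1/d. *)
Lemma harmonic_sum_le_powR (d : R) : 0 < d ->
  exists2 C, 0 < C & forall n, harmonic_sum n <= C * n%:R `^ d.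
Proof.
move=> d0; exists (1 + d^-1) => [|[|n]]; first by rewrite addr_gt0 ?invr_gt0.
  rewrite /harmonic_sum big_ord_recr big_ord0 /= invr0 addr0 mulr_ge0 ?powR_ge0//.
  by rewrite addr_ge0// invr_ge0 ltW.
apply: le_trans (harmonic_sum_le_ln _) _ => //.
have n1 : 1 <= n.+1%:R `^ d :> R.
  by rewrite -[leLHS](powRr0 n.+1%:R) ler_powR ?ler1n// ltW.
have := ln_sublinear (lt_le_trans ltr01 n1); rewrite ln_powR => /ltW h.
rewrite mulrDl mul1r lerD// -ler_pdivrMl ?invr_gt0// invrK//.
Qed.

(** If p >= P > 2^(1/d), then p^d >= 2 and 2^k >= k + 1 suffices. For small p, p^(kd) >= exp(k L) >=
    1 + k L with L = d ln 2, and the factor K = 1 + 1/L lifts this above k + 1. *)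
Lemma exponent_le_powR (d : R) : 0 < d -> exists K : R, exists P : nat,
  1 <= K /\ forall p k, prime p ->
    k.+1%:R <= (if (p < P)%N then K else 1) * (p ^ k)%:R `^ d.
Proof.
move=> d0; have l2 : 0 < ln 2 :> R by rewrite ln_gt0// ltr1n.
have dl : 0 < d * ln 2 by rewrite mulr_gt0.
exists (1 + (d * ln 2)^-1), (Num.Def.truncn (2 `^ d^-1 : R)).+1; split.
  by rewrite lerDl invr_ge0 ltW.
move=> p k pp; have p2 := prime_gt1 pp.
have p2R : 2 <= p%:R :> R by rewrite ler_nat.
have -> : (p ^ k)%:R `^ d = (p%:R `^ d) ^+ k :> R.
  by rewrite natrX -powR_mulrn// -powRrM mulrC powRrM powR_mulrn ?powR_ge0.
case: ltnP => [_|Pp].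
  have H : 1 + k%:R * (d * ln 2) <= (p%:R `^ d) ^+ k.
    apply: (@le_trans _ _ ((2 `^ d) ^+ k)); last first.
      by rewrite lerXn2r ?nnegrE ?powR_ge0// ge0_ler_powR ?nnegrE// ltW.
    rewrite -powR_mulrn ?powR_ge0// -powRrM /powR gt_eqF//.
    rewrite [d * k%:R]mulrC -mulrA; exact: expR_ge1Dx.
  apply: (@le_trans _ _ ((1 + (d * ln 2)^-1) * (1 + k%:R * (d * ln 2)))).
    rewrite -natr1.
    have -> : (1 + (d * ln 2)^-1) * (1 + k%:R * (d * ln 2)) =
      1 + (d * ln 2)^-1 + k%:R * (d * ln 2) + k%:R :> R.
      by move: (d * ln 2) dl => L L0; field; rewrite gt_eqF.
    have : 0 <= (d * ln 2)^-1 by rewrite invr_ge0 ltW.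
    have : 0 <= k%:R * (d * ln 2) by rewrite mulr_ge0// ltW.
    by move: (d * ln 2)^-1 (k%:R * (d * ln 2)) (k%:R : R) => x y z x0 y0; lra.
  by rewrite ler_pM2l// addr_gt0// invr_gt0.
rewrite mul1r.
apply: (@le_trans _ _ (2 ^+ k)); first by rewrite -natrX ler_nat ltn_expl.
apply: lerXn2r; rewrite ?nnegrE ?powR_ge0//.
have -> : 2 = (2 `^ d^-1) `^ d :> R by rewrite -powRrM mulVf ?powRr1// gt_eqF.
rewrite ge0_ler_powR ?nnegrE ?powR_ge0// ?ltW//.
by apply: lt_le_trans (truncnS_gt _) _; rewrite ler_nat.
Qed.

(** Multiply [exponent_le_powR] over the primes of [n]: fewer than P + 1 of them lie below P, so the
    total loss is at most K^P. *)
Lemma size_divisors_le_powR (d : R) : 0 < d ->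
  exists2 C : R, 0 < C & forall n, (0 < n)%N ->
    (size (divisors n))%:R <= C * n%:R `^ d.
Proof.
move=> d0; have [K [P [K1 KP]]] := exponent_le_powR d0.
exists (K ^+ P); first by rewrite exprn_gt0// (lt_le_trans ltr01).
move=> n n0; rewrite size_divisors {2}(prod_prime_decomp n0).
have dE (F : nat * nat -> nat) : (\prod_(f <- prime_decomp n) F f)%N =
  (\prod_(p <- primes n) F (p, logn p n))%N by rewrite prime_decompE big_map.
rewrite !dE /=.
apply: (@le_trans _ _ (\prod_(p <- primes n) (if (p < P)%N then K else 1) *
  \prod_(p <- primes n) ((p ^ logn p n)%:R `^ d))).
  rewrite natr_prod -big_split /= !big_seq; apply: ler_prod => p.
  by rewrite mem_primes => /andP[pp _]; rewrite ler0n KP.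
have -> : \prod_(p <- primes n) ((p ^ logn p n)%:R `^ d) =
    (\prod_(p <- primes n) (p ^ logn p n))%N%:R `^ d :> R.
  rewrite natr_prod; elim: (primes n) => [|p s IHs]; first by rewrite !big_nil powR1.
  by rewrite !big_cons powRM ?IHs// prodr_ge0.
rewrite ler_wpM2r ?powR_ge0//.
have -> : \prod_(p <- primes n) (if (p < P)%N then K else 1) =
    K ^+ count (fun p => p < P)%N (primes n).
  elim: (primes n) => [|p s IHs]; first by rewrite big_nil.
  by rewrite big_cons IHs /=; case: ifP; rewrite ?exprS ?mul1r.
apply: ler_weXn2l => //; rewrite -size_filter -[leqRHS](size_iota 0 P).
apply: uniq_leq_size; first by rewrite filter_uniq// primes_uniq.
by move=> p; rewrite mem_filter mem_iota /= => /andP[].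
Qed.

(** * The sum of the reciprocals of rho(d) *)

(** Write 4k = g^2 h. Then g/k = 4/(g h) <= 4/h, and k determines h injectively with h <= 4q. *)
Lemma sum_sq_dvdn_le (q g : nat) : (0 < g)%N ->
  \sum_(k < q | (g ^ 2 %| 4 * k)%N) k%:R^-1 * g%:R <= 4 * harmonic_sum (4 * q).
Proof.
move=> g0; have g2 : (0 < g ^ 2)%N by rewrite expn_gt0 g0.
pose h (k : 'I_q) := (4 * k %/ g ^ 2)%N.
apply: (@le_trans _ _ (4 * \sum_(k < q | (g ^ 2 %| 4 * k)%N) (h k)%:R^-1)).
  rewrite mulr_sumr; apply: ler_sum => k gk.
  case: (posnP k) => [->|k0]; first by rewrite invr0 mul0r mulr_ge0// invr_ge0.
  have hE : (h k)%:R * g%:R ^+ 2 = 4 * k%:R :> R.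
    by rewrite -natrX -!natrM divnK.
  have kR : 0 < k%:R :> R by rewrite ltr0n.
  have gR : 1 <= g%:R :> R by rewrite ler1n.
  have hR : 0 < (h k)%:R :> R.
    rewrite ltr0n divn_gt0// dvdn_leq//; lia.
  have g0R : 0 < g%:R :> R by rewrite ltr0n.
  have -> : k%:R^-1 * g%:R = 4 * (h k)%:R^-1 * g%:R^-1 :> R.
    have -> : k%:R = (h k)%:R * g%:R ^+ 2 / 4 :> R by rewrite hE mulrC mulKf.
    by move: (h k)%:R hR g%:R g0R => x x0 y y0; field; rewrite !gt_eqF.
  by rewrite ler_piMr ?invf_le1// mulr_ge0// invr_ge0.
rewrite ler_pM2l// /harmonic_sum.
apply: (@ler_sum_inj _ _ h (fun k => k%:R^-1)).
- by move=> k; rewrite invr_ge0.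
- move=> k l; rewrite -!topredE /= => gk gl /(congr1 (fun x => x * g ^ 2)%N).
  rewrite /h !divnK// => e; apply: val_inj => /=; lia.
- move=> k gk; rewrite ltnS; apply: leq_trans (leq_div _ _) _.
  by rewrite leq_mul2l ltnW.
Qed.

(** For q > 0 the remainder is nonnegative, so the absolute value only changes its type. *)
Definition residue (a : int) (q d : nat) : nat := `|(a * d%:Z ^+ 2 %% q)%Z|.

Definition dist_residue (a : int) (q d : nat) : nat :=
  minn (residue a q d) (q - residue a q d).

(* The d with q | a d^2 contribute 0^-1 = 0. *)
Lemma sum_dist_residue_le (q : nat) (a : int) : (0 < q)%N -> coprimez a q ->
  \sum_(d < q) (dist_residue a q d)%:R^-1 <=
    8 * (size (divisors q))%:R * harmonic_sum (4 * q) :> R.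
Proof.
move=> q0 caq.
have resP (d : nat) : (residue a q d : int) = (a * d%:Z ^+ 2 %% q)%Z.
  by rewrite /residue gez0_abs// modz_ge0// -lt0n.
have rltq (d : nat) : (residue a q d < q)%N.
  by rewrite -ltz_nat resP ltz_pmod.
have rhoq (d : 'I_q) : (dist_residue a q d < q)%N.
  by rewrite /dist_residue gtn_min rltq.
rewrite (partition_big (fun d : 'I_q => Ordinal (rhoq d)) predT)//=.
pose G (q1 : nat) := gcdn q1 (q %/ q1).
(* rho(d) = k forces a d^2 to be k or -k modulo q, whence two congruences and the factor 2. *)
have count_rho (k : 'I_q) : (#|[set d : 'I_q | Ordinal (rhoq d) == k]| <=
    2 * \sum_(q1 <- divisors q | (G q1 ^ 2 %| 4 * k)%N) G q1)%N.
  have cP := card_quadratic_congruence k%:Z q0 caq.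
  have cN := card_quadratic_congruence (- k%:Z)%R q0 caq.
  rewrite abszN /= in cN; rewrite /= in cP.
  rewrite mul2n -addnn; apply: leq_trans (leq_add cP cN).
  apply: leq_trans (leq_card_setU _ _).
  apply: subset_leq_card; apply/fintype.subsetP => d; rewrite !inE => /eqP/(congr1 val)/= <-.
  have dE : a * d%:Z ^+ 2 = (a * d%:Z ^+ 2 %/ q)%Z * q + residue a q d.
    by rewrite resP -divz_eq.
  rewrite /dist_residue /minn; case: ltnP => _; apply/orP; [left|right].
    by rewrite {1}dE addrK dvdz_mull.
  rewrite {1}dE opprK -addrA -PoszD subnKC ?(ltnW (rltq d))//.
  by rewrite rpredD// dvdz_mull.
apply: (@le_trans _ _ (\sum_(k < q) k%:R^-1 *
  (2 * \sum_(q1 <- divisors q | (G q1 ^ 2 %| 4 * k)%N) (G q1)%:R))).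
  apply: ler_sum => k _.
  rewrite (eq_bigr (fun=> k%:R^-1)); last by move=> d /eqP <-.
  rewrite sumr_const -[leLHS]mulr_natr ler_wpM2l ?invr_ge0//.
  rewrite -natr_sum -natrM ler_nat; apply: leq_trans (count_rho k).
  by rewrite cardsE.
(* With the sum over k innermost, [sum_sq_dvdn_le] bounds the share of each divisor q1 by 4
   [harmonic_sum (4 * q)]; with the factor 2 this makes 8. *)
have -> : \sum_(k < q) k%:R^-1 *
    (2 * \sum_(q1 <- divisors q | (G q1 ^ 2 %| 4 * k)%N) (G q1)%:R) =
  2 * \sum_(q1 <- divisors q) \sum_(k < q | (G q1 ^ 2 %| 4 * k)%N) k%:R^-1 * (G q1)%:R :> R.
  rewrite mulr_sumr [RHS](eq_bigr (fun q1 => \sum_(k < q)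
      if (G q1 ^ 2 %| 4 * k)%N then 2 * (k%:R^-1 * (G q1)%:R) else 0)); last first.
    by move=> q1 _; rewrite mulr_sumr big_mkcond.
  rewrite exchange_big; apply: eq_bigr => k _ /=.
  by rewrite -big_mkcond mulrCA !mulr_sumr; apply: eq_bigr => q1 _; rewrite mulrCA.
apply: (@le_trans _ _ (2 * \sum_(q1 <- divisors q) (4 * harmonic_sum (4 * q)))).
  rewrite ler_pM2l// !big_seq; apply: ler_sum => q1.
  rewrite -dvdn_divisors// => q1q; apply: sum_sq_dvdn_le.
  by rewrite gcdn_gt0 (dvdn_gt0 q0 q1q).
rewrite big_const_seq iter_addr_0 count_predT -mulr_natl.
by rewrite le_eqVlt; apply/orP; left; apply/eqP; ring.
Qed.

End Estimates.

(** * Rational approximation and the bound for a given denominator *)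

Section MinorArcs.
Variable R : realType.

(** Pigeonhole: two of the L + 1 fractional parts of 0, x, ..., L x fall into the same interval of
    length 1/L. *)
Lemma dirichlet_approximation (x : R) (L : nat) : (0 < L)%N ->
  exists (a : int) (q : nat), [/\ (1 <= q <= L)%N, coprimez a q
    & `|x * q%:R - a%:~R| < L%:R^-1].
Proof.
move=> L0; have LR : 0 < L%:R :> R by rewrite ltr0n.
pose fr (j : nat) := x * j%:R - (Num.floor (x * j%:R))%:~R.
have fr01 j : 0 <= fr j < 1.
  by rewrite /fr subr_ge0 floor_le_tmp ltrBlDr addrC -[1]/(1%:~R) -intrD floorD1_gt.
have fP (j : 'I_L.+1) : (Num.truncn (L%:R * fr j) < L)%N.
  have /andP[j0 j1] := fr01 j.
  by rewrite -(ltr_nat R) (@le_lt_trans _ _ (L%:R * fr j)) ?gtr_pMr// truncn_le mulr_ge0// ltW.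
have [j [l [jl fjl]]] : exists j l : nat, [/\ (j < l)%N, (l <= L)%N &
    Num.truncn (L%:R * fr j) = Num.truncn (L%:R * fr l)].
  have /injectivePn[j [l jl /(congr1 val)/= fjl]] :
      ~~ injectiveb (fun j : 'I_L.+1 => Ordinal (fP j)).
    by apply/negP => /injectiveP/leq_card; rewrite !card_ord ltnn.
  have [h|h] := ltnP j l; first by exists j, l; split=> //; rewrite -ltnS.
  exists l, j; split=> //; last by rewrite -ltnS.
  rewrite ltn_neqAle h andbT eq_sym; apply: contra jl => /eqP/val_inj ->.
  exact: eqxx.
move=> trjl; set b := Num.floor (x * l%:R) - Num.floor (x * j%:R).
have n0 : (0 < l - j)%N by rewrite subn_gt0.
have H : `|x * (l - j)%:R - b%:~R| < L%:R^-1.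
  have -> : x * (l - j)%:R - b%:~R = fr l - fr j.
    by rewrite natrB ?(ltnW jl)// /b intrB /fr; ring.
  have tr k : (Num.truncn (L%:R * fr k))%:R <= L%:R * fr k < (Num.truncn (L%:R * fr k))%:R + 1.
    by rewrite natr1 truncn_itv// mulr_ge0 ?(ltW LR)//; case/andP: (fr01 k).
  have /andP[j1 j2] := tr j; have /andP[l1 l2] := tr l; rewrite trjl in j1 j2.
  rewrite -(ltr_pM2l LR) mulfV ?gt_eqF// -[L%:R in ltLHS](gtr0_norm LR) -normrM mulrBr.
  rewrite ltr_norml; apply/andP; split; lra.
(* Dividing by the gcd achieves coprimality; the denominator does not grow, and the error shrinks by
   the factor [g]. *)
set n := (l - j)%N in n0 H; set g := gcdn `|b| n.
have g0 : (0 < g)%N by rewrite gcdn_gt0 n0 orbT.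
have gb : (g %| b)%Z by rewrite dvdzE dvdn_gcdl.
have gn : (g %| n)%N by rewrite dvdn_gcdr.
exists (b %/ g)%Z, (n %/ g)%N; split.
- rewrite divn_gt0// dvdn_leq//=; apply: leq_trans (leq_div _ _) _.
  by rewrite /n (leq_trans (leq_subr _ _)).
- rewrite coprimezE /=.
  have -> : `|(b %/ g)%Z|%N = (`|b| %/ g)%N.
    by apply/eqP; rewrite -(eqn_pmul2r g0) divnK ?dvdn_gcdl// -[g in (_ * g)%N]absz_nat -abszM divzK.
  by rewrite /coprime -(eqn_pmul2r g0) muln_gcdl !divnK ?dvdn_gcdl ?dvdn_gcdr// mul1n.
apply: le_lt_trans H.
have -> : x * n%:R - b%:~R = g%:R * (x * (n %/ g)%N%:R - (b %/ g)%Z%:~R).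
  rewrite -{1}(divnK gn) -{1}(divzK gb) intrM natrM; ring.
by rewrite normrM (ger0_norm (ler0n R g)) ler_peMl// ler1n.
Qed.

Lemma sqfree_expsumE (N : nat) (alpha : R) : sqfree_expsum N alpha =
  \sum_(1 <= d < N.+1) (mobius d)%:~R *
    \sum_(1 <= m < (N %/ d ^ 2).+1) e (alpha * (d ^ 2)%:R * m%:R).
Proof.
rewrite /sqfree_expsum.
transitivity (\sum_(1 <= n < N.+1) \sum_(1 <= d < N.+1)
   if (d ^ 2 %| n)%N then (mobius d)%:~R * e (alpha * n%:R) else 0).
  rewrite !big_nat; apply: eq_bigr => n nN.
  by rewrite -(sum_mobius_sqdvd nN) rmorph_sum mulr_suml -big_mkcond.
rewrite exchange_big /= !big_nat; apply: eq_bigr => d /andP[d0 _].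
rewrite -big_mkcond sum_dvdn ?expn_gt0 ?d0// mulr_sumr.
by apply: eq_bigr => m _; rewrite natrM mulrA.
Qed.

Lemma normc_inner_sum_le (N Q q d : nat) (a : int) (alpha : R) :
  (0 < N)%N -> (Q <= q)%N -> (0 < q)%N -> (0 < d)%N -> coprimez a q ->
  `|alpha * q%:R - a%:~R| <= Q%:R / N%:R ->
  normc (\sum_(1 <= m < (N %/ d ^ 2).+1) e (alpha * (d ^ 2)%:R * m%:R)) <=
    4 * q%:R * (dist_residue a q d)%:R^-1 +
    (if (q %| d ^ 2)%N then N%:R / (d ^ 2)%:R else 0).
Proof.
move=> N0 Qq q0 d0 caq aq; set T := \sum_(_ <= _ < _) _.
have qR : 0 < q%:R :> R by rewrite ltr0n.
have NR : 0 < N%:R :> R by rewrite ltr0n.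
have dR : 0 < (d ^ 2)%:R :> R by rewrite ltr0n expn_gt0 d0.
have Ttriv : normc T <= N%:R / (d ^ 2)%:R.
  apply: le_trans (normc_expsum_le _ _) _.
  by rewrite ler_pdivlMr// -natrM ler_nat leq_divM.
have resE : (residue a q d : int) = (a * d%:Z ^+ 2 %% q)%Z.
  by rewrite /residue gez0_abs// modz_ge0// -lt0n.
have rq : (residue a q d < q)%N by rewrite -ltz_nat resE ltz_pmod.
have adE : a * d%:Z ^+ 2 = (a * d%:Z ^+ 2 %/ q)%Z * q + residue a q d.
  by rewrite resE -divz_eq.
(* If the residue is zero, coprimality of a and q gives q | d^2; the reciprocal of rho is then 0 and
   the trivial bound fills the second term. *)
have [r0|r0] := posnP (residue a q d).
  have -> : (q %| d ^ 2)%N.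
    have : (q %| a * d%:Z ^+ 2)%Z by apply/dvdz_mod0P; rewrite -resE r0.
    by rewrite Gauss_dvdzr 1?coprimez_sym// dvdzE abszX.
  by rewrite (le_trans Ttriv)// lerDr mulr_ge0// ?invr_ge0// mulr_ge0.
apply: (@le_trans _ _ (4 * q%:R * (dist_residue a q d)%:R^-1)); last first.
  by rewrite lerDl; case: ifP => // _; rewrite divr_ge0.
set rho := dist_residue a q d.
have rho0 : 0 < rho%:R :> R by rewrite ltr0n /rho /dist_residue leq_min r0 subn_gt0.
set k := (a * d%:Z ^+ 2 %/ q)%Z in adE.
(* The distance of alpha d^2 from k + r/q is d^2/q times the error of the approximation a/q, scaled
   by q. *)
have tE : alpha * (d ^ 2)%:R - k%:~R - (residue a q d)%:R / q%:R =
    (d ^ 2)%:R * (alpha * q%:R - a%:~R) / q%:R.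
  have /(congr1 (fun z : int => z%:~R : R)) := adE.
  rewrite expr2 -PoszM mulnn intrD !intrM -!pmulrn => h.
  apply: (mulIf (lt0r_neq0 qR)); rewrite divfK ?gt_eqF//.
  rewrite mulrBr [(d ^ 2)%:R * a%:~R]mulrC h !mulrBl divfK ?gt_eqF//; ring.
have tle : `|alpha * (d ^ 2)%:R - k%:~R - (residue a q d)%:R / q%:R| <=
    (d ^ 2)%:R * (Q%:R / N%:R) / q%:R.
  by rewrite tE !normrM [ `|q%:R^-1|]ger0_norm ?invr_ge0// ger0_norm// ler_pM2r ?invr_gt0// ler_pM2l.
have [small|big] := lerP ((d ^ 2)%:R * (Q%:R / N%:R) / q%:R) (rho%:R / (4 * q%:R) : R).
  have rq' : (0 < residue a q d < q)%N by rewrite r0.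
  apply: le_trans (normc_geom_frac _ rq' (le_trans tle small)) _.
  by rewrite -/rho ler_pM2r ?invr_gt0// ler_pM2r// ler_nat.
(* Here rho < 4 d^2 Q/N, so the trivial bound N/d^2 is below 4Q/rho <= 4q/rho. *)
apply: (le_trans Ttriv); rewrite ler_pdivrMr// mulrAC ler_pdivlMr//.
move: big; rewrite ltr_pdivrMr ?mulr_gt0//.
have -> : (d ^ 2)%:R * (Q%:R / N%:R) / q%:R * (4 * q%:R) = (d ^ 2)%:R * Q%:R * 4 / N%:R :> R.
  by field; rewrite !gt_eqF.
rewrite ltr_pdivlMr// => /ltW h; rewrite mulrC (le_trans h)//.
have : Q%:R <= q%:R :> R by rewrite ler_nat.
by move/(ler_wpM2l (ltW dR)); lra.
Qed.
(** Dirichlet with L = floor(N/Q) + 1 gives 1/L < Q/N and q Q <= N + Q <= 2N; a denominator q <= Q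
    would put [alpha] on a major arc. *)
Lemma minor_arcs_approximation (N Q : nat) (alpha : R) : (0 < Q <= N)%N ->
  minor_arcs N Q alpha -> exists (a : int) (q : nat),
    [/\ (Q < q)%N, (q * Q <= 2 * N)%N, coprimez a q
      & `|alpha * q%:R - a%:~R| <= Q%:R / N%:R].
Proof.
move=> /andP[Q0 QN] [_ nmajor]; have N0 := leq_trans Q0 QN.
have [a [q [/andP[q1 qL] caq aq]]] := dirichlet_approximation alpha (ltn0Sn (N %/ Q)).
have {}aq : `|alpha * q%:R - a%:~R| <= Q%:R / N%:R.
  apply: (le_trans (ltW aq)); rewrite -[leRHS]invf_div lef_pV2 ?posrE ?divr_gt0 ?ltr0n//.
  rewrite ler_pdivrMr ?ltr0n// -natrM ler_nat ltnW//.
  exact: ltn_ceil.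
exists a, q; split=> //; last by have := leq_divM N Q; nia.
rewrite ltnNge; apply/negP => qQ; apply: nmajor; exists a, q; split=> //.
by rewrite q1.
Qed.

Lemma sum_inv_sq_tail_le (Q N : nat) : (0 < Q)%N ->
  \sum_(Q.+1 <= d < N.+1) (d ^ 2)%:R^-1 <= Q%:R^-1 :> R.
Proof.
move=> Q0; have [NQ|QN] := ltnP N Q; first by rewrite big_geq ?invr_ge0// ltnS ltnW.
(* The sharper bound 1/Q - 1/N is inductive, by 1/(N + 1)^2 <= 1/N - 1/(N + 1). *)
suff : \sum_(Q.+1 <= d < N.+1) (d ^ 2)%:R^-1 <= Q%:R^-1 - N%:R^-1 :> R.
  by move=> /le_trans; apply; rewrite gerBl invr_ge0.
elim: N QN => [|N IHN] QN; first by move: QN; rewrite leqNgt Q0.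
move: QN; rewrite leq_eqVlt => /predU1P[->|QN]; first by rewrite big_geq// subrr.
rewrite big_nat_recr//=.
apply: (le_trans (lerD (IHN QN) (lexx _))).
have NR : 0 < N%:R :> R by rewrite ltr0n; lia.
rewrite -addrA lerD2l -lerBrDl opprK addrC natrX -natr1.
have -> : N%:R^-1 - (N%:R + 1)^-1 = ((N%:R + 1) * N%:R)^-1 :> R.
  by field; rewrite !gt_eqF// addr_gt0.
rewrite lef_pV2 ?posrE ?exprn_gt0 ?mulr_gt0 ?addr_gt0//.
by rewrite expr2 ler_pM2l ?addr_gt0// lerDl.
Qed.

(** Write d^2 = q k; then d determines k injectively, and k <= Q because d^2 <= Q^2 <= q Q. *)
Lemma sum_sq_multiples_le (Q q : nat) : (0 < q)%N -> (Q <= q)%N ->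
  \sum_(1 <= d < Q.+1 | (q %| d ^ 2)%N) (d ^ 2)%:R^-1 <=
    q%:R^-1 * harmonic_sum R Q.
Proof.
move=> q0 Qq; pose h (d : 'I_Q.+1) := (d ^ 2 %/ q)%N.
apply: (@le_trans _ _ (\sum_(d < Q.+1 | (q %| d ^ 2)%N) q%:R^-1 * (h d)%:R^-1)).
  rewrite -(big_mkord (fun d => q %| d ^ 2)%N (fun d => q%:R^-1 * (d ^ 2 %/ q)%:R^-1)).
  rewrite [leRHS]big_ltn_cond//= exp0n// dvdn0 div0n invr0 mulr0 add0r.
  by apply: ler_sum => d qd; rewrite -invfM -natrM mulnC divnK.
rewrite -mulr_sumr ler_pM2l ?invr_gt0 ?ltr0n//.
apply: (@ler_sum_inj _ _ _ h (fun k => k%:R^-1)).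
- by move=> k; rewrite invr_ge0.
- move=> d d'; rewrite -!topredE /= => qd qd' /(congr1 (fun x => x * q)%N).
  by rewrite /h !divnK// => /eqP; rewrite eqn_exp2r// => /eqP/val_inj.
- move=> d _; rewrite ltnS /h; have dQ := ltn_ord d.
  by rewrite -(leq_pmul2r q0) (leq_trans (leq_divM _ _))//; nia.
Qed.

(** The three terms come from d > Q, from d <= Q with q | d^2, and from the remaining d <= Q; the
    constant is 32 = 4 * 8. *)
Lemma normc_sqfree_expsum_le (N Q q : nat) (a : int) (alpha : R) :
  (0 < Q <= N)%N -> (Q < q)%N -> coprimez a q ->
  `|alpha * q%:R - a%:~R| <= Q%:R / N%:R ->
  normc (sqfree_expsum N alpha) <= N%:R / Q%:R +
    (N%:R / q%:R * harmonic_sum R Q +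
     32 * q%:R * (size (divisors q))%:R * harmonic_sum R (4 * q)).
Proof.
move=> /andP[Q0 QN] Qq caq aq; have N0 := leq_trans Q0 QN.
have q0 : (0 < q)%N by apply: leq_ltn_trans Qq.
pose T d := \sum_(1 <= m < (N %/ d ^ 2).+1) e (alpha * (d ^ 2)%:R * m%:R).
have ST : normc (sqfree_expsum N alpha) <= \sum_(1 <= d < N.+1) normc (T d).
  rewrite sqfree_expsumE (le_trans (normc_sum _ _ _))//.
  apply: ler_sum => d _; rewrite normcM -[leRHS]mul1r ler_wpM2r ?normc_ge0//.
  have -> : normc ((mobius d)%:~R : R[i]) = (`|mobius d|%:~R : R).
    have -> : (mobius d)%:~R = ((mobius d)%:~R : R)%:C by rewrite rmorph_int.
    by rewrite /normc /= expr0n addr0 sqrtr_sqr intr_norm.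
  by rewrite -[leRHS]/(1%:~R) ler_int norm_mobius_le1.
apply: (le_trans ST); rewrite (big_cat_nat (n := Q.+1))//= addrC lerD//.
  apply: (@le_trans _ _ (N%:R * \sum_(Q.+1 <= d < N.+1) (d ^ 2)%:R^-1)).
    rewrite mulr_sumr !big_nat; apply: ler_sum => d /andP[Qd _].
    have d0 : (0 < d)%N by apply: leq_ltn_trans Qd.
    rewrite (le_trans (normc_expsum_le _ _))//.
    by rewrite ler_pdivlMr ?ltr0n ?expn_gt0 ?d0// -natrM ler_nat leq_divM.
  by rewrite ler_pM2l ?ltr0n// sum_inv_sq_tail_le.
apply: (@le_trans _ _ (\sum_(1 <= d < Q.+1) (4 * q%:R * (dist_residue a q d)%:R^-1 +
    (if (q %| d ^ 2)%N then N%:R / (d ^ 2)%:R else 0)))).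
  rewrite !big_nat; apply: ler_sum => d /andP[d0 _].
  by apply: (@normc_inner_sum_le N Q) => //; apply: ltnW.
rewrite big_split /= addrC lerD//.
  by rewrite -big_mkcond -mulr_sumr -mulrA ler_pM2l ?ltr0n// sum_sq_multiples_le// ltnW.
have -> : 32 * q%:R * (size (divisors q))%:R * harmonic_sum R (4 * q) =
   4 * q%:R * (8 * (size (divisors q))%:R * harmonic_sum R (4 * q)) by ring.
rewrite -mulr_sumr ler_pM2l ?mulr_gt0 ?ltr0n//.
apply: le_trans (sum_dist_residue_le R q0 caq).
rewrite -(big_mkord predT (fun d => (dist_residue a q d)%:R^-1)).
(* As Q < q, the range 1..Q sits inside 0..q-1, and the extra terms are nonnegative. *)
rewrite [leRHS](big_cat_nat (n := Q.+1))//= [X in _ <= X + _](big_cat_nat (n := 1%N))//=.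
by rewrite addrAC lerDr addr_ge0// sumr_ge0// => d _; rewrite invr_ge0.
Qed.

End MinorArcs.

(** * Choice of exponents and constants *)

Local Open Scope classical_set_scope.
Local Open Scope ring_scope.
Local Open Scope complex_scope.

(* The norm of R[i] is R[i]-valued; z <= r%:C compares real parts and forces
   equality of imaginary parts, here both zero. *)
Theorem theorem1 (R : realType) (eps : R) (heps : 0 < eps) :
  exists C : R, 0 < C /\
    forall N Q : nat, (0 < N)%N -> (0 < Q)%N -> Q%:R <= Num.sqrt (N%:R : R) ->
    forall alpha : R, minor_arcs N Q alpha ->
      `|sqfree_expsum N alpha| <= (C * (N%:R `^ (1 + eps)) / Q%:R)%:C.
Proof.
(* The divisor bound and the harmonic sum each cost a power N^d, so their product costs N^eps. *)
pose d := eps / 2; have d0 : 0 < d by rewrite divr_gt0.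
have [C1 C10 HC1] := harmonic_sum_le_powR d0.
have [C2 C20 HC2] := size_divisors_le_powR d0.
(* One summand for each term of [normc_sqfree_expsum_le]. The 64 is 32 * 2 from q <= 2N/Q; the
   powers of 2 and 8 come from q <= 2N and 4q <= 8N. *)
exists (1 + C1 + 64 * C2 * C1 * (2 `^ d * 8 `^ d)); split.
  by rewrite addr_gt0 ?addr_gt0// !mulr_gt0// powR_gt0.
move=> N Q N0 Q0 Qs alpha minor.
have NR : 1 <= N%:R :> R by rewrite ler1n.
have NR0 : 0 < N%:R :> R by rewrite ltr0n.
have QR0 : 0 < Q%:R :> R by rewrite ltr0n.
have QN : (Q <= N)%N.
  have : Q%:R ^+ 2 <= N%:R :> R by rewrite -[leRHS]sqr_sqrtr ?lerXn2r ?nnegrE ?sqrtr_ge0.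
  by rewrite -natrX ler_nat; nia.
have [a [q [Qq qQ caq aq]]] := minor_arcs_approximation (introT andP (conj Q0 QN)) minor.
have q0 : (0 < q)%N by apply: leq_ltn_trans Qq.
have qR0 : 0 < q%:R :> R by rewrite ltr0n.
rewrite -[`|_|]/(normc _)%:C lecR.
apply: (le_trans (normc_sqfree_expsum_le (introT andP (conj Q0 QN)) Qq caq aq)).
set X := N%:R `^ d.
have X1 : 1 <= X by rewrite -[leLHS](powRr0 N%:R) ler_powR// ltW.
have X0 := lt_le_trans ltr01 X1.
have XE : N%:R `^ (1 + eps) = N%:R * X ^+ 2.
  rewrite powRD ?(gt_eqF NR0) ?implybT// powRr1// -powR_mulrn ?powR_ge0//.
  by rewrite /X -powRrM /d divfK.
have XX : X <= X ^+ 2 by rewrite expr2 ler_peMl// ltW.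
have mono (m k : nat) : (m <= k * N)%N -> m%:R `^ d <= k%:R `^ d * X.
  move=> mk; rewrite -powRM// -natrM ge0_ler_powR ?nnegrE// ?ler_nat//; exact: ltW.
have H1 : harmonic_sum R Q <= C1 * X.
  by rewrite (le_trans (HC1 _))// ler_pM2l// (le_trans (mono Q 1%N _)) ?mul1n// powR1 mul1r.
have q2N : (q <= 2 * N)%N := leq_trans (leq_pmulr q Q0) qQ.
have H4 : harmonic_sum R (4 * q) <= C1 * (8 `^ d * X).
  by rewrite (le_trans (HC1 _))// ler_pM2l// mono// -[8%N]/(4 * 2)%N -mulnA leq_mul2l.
have H2 : (size (divisors q))%:R <= C2 * (2 `^ d * X).
  by rewrite (le_trans (HC2 _ q0))// ler_pM2l// mono.
set Y := N%:R / Q%:R; have Y0 : 0 < Y by rewrite divr_gt0.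
have qY : q%:R <= 2 * Y by rewrite /Y mulrA ler_pdivlMr// -!natrM ler_nat.
set K := 64 * C2 * C1 * (2 `^ d * 8 `^ d).
have -> : (1 + C1 + K) * N%:R `^ (1 + eps) / Q%:R =
    X ^+ 2 * Y + (C1 * X ^+ 2 * Y + K * X ^+ 2 * Y) by rewrite XE /Y; ring.
apply: lerD; first by rewrite -[leLHS]mul1r ler_pM2r// (le_trans X1).
apply: lerD.
  apply: (@le_trans _ _ (Y * (C1 * X))); last first.
    by rewrite mulrC ler_pM2r// ler_pM2l.
  apply: ler_pM; rewrite ?divr_ge0 ?harmonic_sum_ge0//.
  by rewrite ler_pM2l// lef_pV2 ?posrE// ler_nat ltnW.
apply: (@le_trans _ _ (32 * (2 * Y) * (C2 * (2 `^ d * X)) * (C1 * (8 `^ d * X)))).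
  apply: ler_pM => //; rewrite ?harmonic_sum_ge0 ?mulr_ge0//.
  by apply: ler_pM => //; rewrite ?mulr_ge0// ler_pM2l.
by rewrite le_eqVlt; apply/orP; left; apply/eqP; rewrite /K; ring.
Qed.
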